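(* Let $f$ be a unimodal map satisfying the standing assumptions in the context. The following are equivalent. (i) For every symmetric neighbourhood $U\ni c$ there exists $N\in\mathbb N$ such that $U\not\subset\widetilde D_n$ for every $n>N$. (ii) For all $M\in\mathbb N$ there exists $N\in\mathbb N$ such that whenever $n\ge N$ is a cutting or co-cutting time, either $\mathcal R(n-s(n))>M$ or $\mathcal R(n-\tilde s(n))>M$.
   Context: A unimodal map is a continuous $f:[0,1]\to[0,1]$ with a turning point $c\in(0,1)$ such that $f|_{[0,c]}$ is strictly increasing and $f|_{[c,1]}$ is strictly decreasing; $c_i=f^i(c)$. Standing assumptions: $c_2<c<c_1$ and $c_2<c_3$; $f$ has no periodic attractor and is not renormalizable (there is no $n>1$ and interval $J\subset[c_2,c_1]$ containing $c$ with $f^n(J)\subset J$ and $J,f(J),\dots,f^{n-1}(J)$ having disjoint interiors); the contraction principle holds: for every $\varepsilon>0$ there is $\delta>0$ such that $|f^n(J)|>\delta$ for every $n>0$ and every interval $J$ with $|J|>\varepsilon$. The turning point is recurrent ($c\in\omega(c)$) and not periodic. $\mathcal K(f)=e_1e_2e_3\cdots$ with $e_i=1$ if $c_i>c$ and $e_i=0$ if $c_i<c$. For $n\ge1$, $\mathcal R(n)=\min\{j\ge1: e_{n+j}\ne e_j\}$. Cutting times: $S_0=1$, $S_{k+1}=S_k+\mathcal R(S_k)$. Co-cutting times: $T_1=\min\{j>1: e_j=1\}$, $T_{i+1}=T_i+\mathcal R(T_i)$. For $n>T_1$, $s(n)$ is the largest cutting time $<n$ and $\tilde s(n)$ is the largest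 co-cutting time $<n$. $\widetilde D_n$ is the interval with endpoints $c_{n-\tilde s(n)}$ and $c_{n-s(n)}$; equivalently $\widetilde D_n=f^{n-1}(H_n)$ where $H_n\ni c_1$ is the maximal open interval on which $f^{n-1}$ is monotone. A symmetric neighbourhood of $c$ is an interval $(u,\hat u)\ni c$ with $\hat u=2c-u$. *)

(* Defs.v *)
From HB Require Import structures.
From mathcomp Require Import all_boot all_order all_algebra.
From mathcomp Require Import all_classical all_reals all_analysis.
Set Implicit Arguments.
Unset Strict Implicit.
Unset Printing Implicit Defensive.
Import Order.TTheory GRing.Theory Num.Theory.
Import numFieldNormedType.Exports.
Local Open Scope classical_set_scope.
Local Open Scope ring_scope.

Section Dynamics.
Context {R : realType}.
Implicit Types (f : R -> R) (c p x : R).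

(* Only the values of f on [0, 1] matter. *)
Record unimodal f c : Prop := Unimodal {
  unimodal_turning : 0 < c < 1 ;
  unimodal_maps : forall x, 0 <= x <= 1 -> 0 <= f x <= 1 ;
  unimodal_continuous : {within `[0, 1], continuous f} ;
  unimodal_increasing : {in `[0, c] &, {homo f : x y / x < y}} ;
  unimodal_decreasing : {in `[c, 1] &, {homo f : x y /~ x < y}}
}.

Definition orbit_set f x : set R := [set iter n f x | n in setT].

Definition omega_limit f x : set R := cluster ((fun n => iter n f x) @ \oo).

Definition periodic f p : Prop := exists2 n, (0 < n)%N & iter n f p = p.

Definition basin f p : set R :=
  [set x | 0 <= x <= 1 /\ omega_limit f x = orbit_set f p].

(* The basin need only contain some open interval, so that one-sided
   (parabolic) attractors count as periodic attractors. *)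
Definition has_periodic_attractor f : Prop :=
  exists p, [/\ 0 <= p <= 1, periodic f p & (basin f p)° !=set0].

(* J = [set c] is not ruled out, but it qualifies only if c is periodic. *)
Definition renormalizable f c : Prop :=
  exists (n : nat) (J : set R),
    [/\ (1 < n)%N,
        is_interval J /\ J `<=` `[iter 2 f c, iter 1 f c],
        J c,
        iter n f @` J `<=` J
      & trivIset `I_n (fun i => (iter i f @` J)°)].

(* Length of a bounded interval. *)
Definition ilength (J : set R) : R := sup J - inf J.

Definition contraction_principle f : Prop :=
  forall eps : R, 0 < eps -> exists2 delta : R, 0 < delta &
    forall (n : nat) (J : set R), (0 < n)%N ->
      is_interval J -> J `<=` `[0, 1] ->
      eps < ilength J -> delta < ilength (iter n f @` J).

Record standing_assumptions f c : Prop := StandingAssumptions {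
  standing_c2_c_c1 : iter 2 f c < c < iter 1 f c ;
  standing_c2_c3 : iter 2 f c < iter 3 f c ;
  standing_no_attractor : ~ has_periodic_attractor f ;
  standing_nonrenormalizable : ~ renormalizable f c ;
  standing_contraction : contraction_principle f ;
  standing_recurrent : omega_limit f c c ;
  standing_not_periodic : ~ periodic f c
}.

(* The minimum of P, with junk value 0 when P is empty. *)
Definition least (P : set nat) : nat :=
  xget 0%N [set j | P j /\ forall i, P i -> (j <= i)%N].

(* The digit e_i, for i >= 1; true stands for 1. When c is not periodic,
   c_i is never c, so that false means c_i < c. *)
Definition kneading f c (i : nat) : bool := c < iter i f c.

(* For n >= 1; the set is nonempty for every such n under the standing
   assumptions, so the junk value of least is not used. *)
Definition agree f c (n : nat) : nat :=
  least [set j | (1 <= j)%N /\ kneading f c (n + j) <> kneading f c j].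

Fixpoint cutting_time f c (k : nat) : nat :=
  if k is k'.+1 then (cutting_time f c k' + agree f c (cutting_time f c k'))%N
  else 1%N.

Definition first_cocutting f c : nat :=
  least [set j | (1 < j)%N /\ kneading f c j].

(* Shifted by one: the value at i is T_(i+1). *)
Fixpoint cocutting_time f c (i : nat) : nat :=
  if i is i'.+1
  then (cocutting_time f c i' + agree f c (cocutting_time f c i'))%N
  else first_cocutting f c.

Definition is_cutting f c (n : nat) : Prop :=
  exists k, cutting_time f c k = n.

Definition is_cocutting f c (n : nat) : Prop :=
  exists i, cocutting_time f c i = n.

(* Meaningful for n > T_1; the maximum of an empty family is 0. *)
Definition last_cutting f c (n : nat) : nat :=
  \max_(m < n | `[< is_cutting f c m >]) m.

Definition last_cocutting f c (n : nat) : nat :=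
  \max_(m < n | `[< is_cocutting f c m >]) m.

(* The open interval, as it is the monotone image of the open interval H_n;
   its two endpoints can come in either order. *)
Definition Dtilde f c (n : nat) : set R :=
  let a := iter (n - last_cocutting f c n) f c in
  let b := iter (n - last_cutting f c n) f c in
  `]Num.min a b, Num.max a b[.

Definition symmetric_nbhd c (U : set R) : Prop :=
  exists2 u, u < c & U = [set` `]u, 2 * c - u[].

End Dynamics.

(* Main.v *)
(** For large n, the point c lies in the interval with endpoints c_(n-s(n)) and
    c_(n-s~(n)) exactly when n is a cutting or co-cutting time. It remains to
    compare the distance from c_m to c with R(m), uniformly in m. Points close
    to c have a large R by continuity. Conversely, if R(m) were unbounded while
    c_m stays away from c, the contraction principle would keep c_(m+j) away
    from c_j for as long as both follow the same itinerary; applied at two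
    successive close returns c_n, c_n' on the same side of c, this forces c_n
    and c_n' to have the same itinerary, so that the kneading sequence is
    eventually periodic. Then c_(n+2pk) is monotone in k and converges to a
    periodic point, which makes c periodic, as c is recurrent. *)
Require Import Defs.
From HB Require Import structures.
From mathcomp Require Import all_boot all_order all_algebra.
From mathcomp Require Import all_classical all_reals all_analysis.
From mathcomp Require Import zify lra.
Import Order.TTheory GRing.Theory Num.Theory.
Import numFieldNormedType.Exports.
Local Open Scope classical_set_scope.
Local Open Scope ring_scope.

Lemma leastP (P : set nat) : P !=set0 ->
  P (least P) /\ forall i, P i -> (least P <= i)%N.
Proof.
move=> [n Pn]; apply: (@xgetPex _ _ [set j | P j /\ _]).
have ex : exists i, `[< P i >] by exists n; apply/asboolP.
case: (ex_minnP ex) => j /asboolP Pj minj; exists j; split=> // i Pi.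
by apply: minj; apply/asboolP.
Qed.

(** * Strictly increasing sequences of natural numbers *)

Section IncreasingSequence.
Context {A : nat -> nat}.
Hypothesis Ainc : forall k, (A k < A k.+1)%N.

(** Has the shape of [last_cutting] and [last_cocutting], so that it is convertible to each of them
    for the corresponding [A]. *)
Definition last_before n : nat :=
  (\max_(m < n | `[< exists k, A k = m >]) m)%N.

Lemma incr_mono : {mono A : j k / (j < k)%N}.
Proof. exact/leqW_mono/leq_mono/(homo_ltn ltn_trans). Qed.

Lemma last_beforeE {k n} : (A k < n <= A k.+1)%N -> last_before n = A k.
Proof.
move=> /andP[ltn len]; apply/eqP; rewrite eqn_leq; apply/andP; split.
  apply/bigmax_leqP => m /asboolP[j Aj]; rewrite leqNgt; apply/negP => lt.
  have : (A j < A k.+1)%N by rewrite Aj (leq_trans _ len).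
  by move: lt; rewrite -Aj !incr_mono; lia.
by apply: (leq_bigmax_cond (Ordinal ltn)); apply/asboolP; exists k.
Qed.

Lemma incr_bracket {n} : (A 0 < n)%N -> exists k, (A k < n <= A k.+1)%N.
Proof.
have geid k : (k <= A k)%N by elim: k => // k ih; exact: leq_ltn_trans (Ainc k).
move=> A0; have ex : exists k, (n <= A k)%N by exists n.
case: (ex_minnP ex) => -[|k] nk mink; first by lia.
exists k; rewrite nk andbT ltnNge; apply/negP => /mink; lia.
Qed.

End IncreasingSequence.
Arguments last_before : clear implicits.

(** The endpoints are unordered because f swaps them to the right of c. *)
Definition between {R : realType} (x y z : R) := (x <= y <= z) || (z <= y <= x).

Lemma betweenC {R : realType} (x y z : R) : between x y z = between z y x.
Proof. exact: orbC. Qed.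

(** * Betweenness, sides of the turning point and itineraries *)

Section Kneading.
Context {R : realType} {f : R -> R} {c : R}.
Hypotheses (hf : unimodal f c) (hs : standing_assumptions f c).
Local Notation o i := (iter i f c).
Local Notation e := (kneading f c).

Lemma c01 : 0 <= c <= 1.
Proof. by case: hf => /andP[/ltW -> /ltW ->]. Qed.

Lemma iter01 x i : 0 <= x <= 1 -> 0 <= iter i f x <= 1.
Proof. by move=> x01; elim: i => //= i; exact: (unimodal_maps hf). Qed.

Lemma orbit01 i : 0 <= o i <= 1.
Proof. exact/iter01/c01. Qed.

Lemma le_left x y : 0 <= x -> x <= y -> y <= c -> f x <= f y.
Proof.
move=> x0; rewrite le_eqVlt => /orP[/eqP -> //|xy] yc.
by apply/ltW/(unimodal_increasing hf); rewrite // in_itv /=; lra.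
Qed.

Lemma le_right x y : c <= x -> x <= y -> y <= 1 -> f y <= f x.
Proof.
move=> xc; rewrite le_eqVlt => /orP[/eqP -> //|xy] yc.
by apply/ltW/(unimodal_decreasing hf); rewrite // in_itv /=; lra.
Qed.

(** Both sides are closed, so an interval with c as an endpoint still counts as one-sided. *)
Definition same_side x y := (x <= c /\ y <= c) \/ (c <= x /\ c <= y).

Lemma between_f x y z : 0 <= x <= 1 -> 0 <= z <= 1 -> same_side x z ->
  between x y z -> between (f x) (f y) (f z).
Proof.
move=> /andP[x0 x1] /andP[z0 z1] side.
by move=> /orP[] /andP[h1 h2]; case: side => -[h3 h4]; apply/orP;
   [left|right|right|left]; apply/andP; split;
   first [by apply: le_left; lra | by apply: le_right; lra].
Qed.

Lemma orbit_neq i : (0 < i)%N -> o i != c.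
Proof.
by move=> i0; apply/eqP => ic; apply: (standing_not_periodic hs); exists i.
Qed.

Lemma kneadingN i : (0 < i)%N -> (o i < c) = ~~ e i.
Proof. by move=> /orbit_neq ne; rewrite /kneading -leNgt lt_neqAle ne. Qed.

Lemma side_turning x : same_side c x.
Proof. by rewrite /same_side; case: (leP x c) => [|/ltW]; [left|right]. Qed.

Lemma kneading_same_side i j : (0 < i)%N -> (0 < j)%N -> e i = e j ->
  same_side (o i) (o j).
Proof.
rewrite /same_side; move=> i0 j0; have := kneadingN i i0; have := kneadingN j j0.
rewrite /kneading; case: (ltrgtP c (o i)); case: (ltrgtP c (o j)) => //=;
  by [left|right|right; split; lra|left; split; lra].
Qed.

Lemma between_kneading i j k : (0 < i)%N -> (0 < j)%N -> (0 < k)%N ->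
  between (o i) (o j) (o k) -> e i = e k -> e j = e i.
Proof.
move=> i0 j0 k0; have := kneadingN i i0; have := kneadingN j j0.
have := kneadingN k k0; rewrite /between /kneading.
case: (ltrP c (o i)); case: (ltrP c (o j)); case: (ltrP c (o k)) => //=; lra.
Qed.

(** As c separates c_i from c_j, cutting the interval at c leaves c_j in the piece ending at c_k. *)
Lemma between_turning i j k : (0 < i)%N -> (0 < j)%N ->
  between (o i) (o j) (o k) -> e j <> e i -> between c (o j) (o k).
Proof.
move=> i0 j0; have := kneadingN i i0; have := kneadingN j j0.
rewrite /between /kneading.
by case: (ltrP c (o i)); case: (ltrP c (o j)) => //=; lra.
Qed.

(** As long as the two ends share their digits, f is monotone on the interval between them and the
    middle point is carried along. *)
Lemma between_agree a d b L : (0 < a)%N -> (0 < b)%N -> (0 < d)%N ->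
  (forall j, (j < L)%N -> e (a + j)%N = e (b + j)%N) ->
  between (o a) (o d) (o b) ->
  forall j, (j < L)%N -> e (d + j)%N = e (a + j)%N.
Proof.
move=> a0 b0 d0 H bt.
have bts j : (j <= L)%N -> between (o (a + j)) (o (d + j)) (o (b + j)).
  elim: j => [|j ih] jL; first by rewrite !addn0.
  rewrite !addnS !iterS; apply: between_f; try exact: orbit01; last exact/ih/ltnW.
  by apply: kneading_same_side; rewrite ?addn_gt0 ?a0 ?b0 // H.
move=> j jL.
apply: (between_kneading _ _ (b + j)); rewrite ?addn_gt0 ?a0 ?b0 ?d0 //.
  exact/bts/ltnW.
exact: H.
Qed.

(** Each digit 1 is a passage through the decreasing branch, so an odd count means that f^L reverses
    the order along this itinerary. *)
Definition orientation a L := odd (\sum_(j < L) e (a + j)%N).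

Lemma le_iterate a b L : (0 < a)%N -> (0 < b)%N ->
  (forall j, (j < L)%N -> e (a + j)%N = e (b + j)%N) -> o a <= o b ->
  if orientation a L then o (b + L) <= o (a + L) else o (a + L) <= o (b + L).
Proof.
move=> a0 b0 + ab; elim: L => [|L ih] H.
  by rewrite /orientation big_ord0 !addn0.
rewrite /orientation big_ord_recr oddD -/(orientation a L) !addnS !iterS /=.
have {}ih := ih (fun j jL => H j (ltnW jL)).
have eab := H L (ltnSn L).
have := kneading_same_side (a + L) (b + L).
rewrite !addn_gt0 a0 b0 => /(_ erefl erefl eab).
have /andP[a01 a11] := orbit01 (a + L); have /andP[b01 b11] := orbit01 (b + L).
have := kneadingN (a + L); rewrite addn_gt0 a0 => /(_ erefl); rewrite /kneading.
have := kneadingN (b + L); rewrite addn_gt0 b0 => /(_ erefl).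
rewrite -eab /kneading; case: (ltrP c (o (a + L))) => /= ca h1 h2 _;
  by case: (orientation a L) ih => ih /=;
     first [by apply: le_left; lra | by apply: le_right; lra].
Qed.

(** * Recurrence and aperiodicity of the kneading sequence *)

Lemma recurrence (eps : R) N : 0 < eps ->
  exists m, (N <= m)%N /\ `|o m - c| < eps.
Proof.
move=> eps0; have /(_ [set o m | m in [set m | (N <= m)%N]] (ball c eps)) :=
  standing_recurrent hs.
case.
- by exists N => // m /= Nm; exists m.
- exact: nbhsx_ballx.
- by move=> _ [[m Nm <-]]; rewrite /ball /= distrC => h; exists m.
Qed.

(** Continuity is given only within [0, 1], hence the bounds on [z] and [l]. *)
Lemma cvg_iter {T} {F : set_system T} {FF : Filter F} (z : T -> R) (l : R) i :
  (\forall k \near F, 0 <= z k <= 1) -> 0 <= l <= 1 -> z @ F --> l ->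
  (fun k => iter i f (z k)) @ F --> iter i f l.
Proof.
move=> z01 l01 zl; elim: i => [//|i ih] /=.
have /subspace_continuousP/(_ (iter i f l)) := unimodal_continuous hf.
rewrite /= in_itv /= => /(_ (iter01 _ _ l01)) cf.
apply: (cvg_comp (fun k => iter i f (z k)) f _ cf) => B /= wB.
have := ih _ wB; rewrite /= !near_simpl => hB.
near=> k; apply: (near hB k) => //; rewrite /= in_itv /=.
by apply: iter01; near: k.
Unshelve. all: by end_near.
Qed.

Lemma orbit_shift n i : o (n + i) = iter i f (o n).
Proof. by rewrite addnC iterD. Qed.

(* The limit is a periodic point attracting the orbit of c, so by recurrence
   c is one of its iterates. *)
Lemma cvg_subsequence_false n q : (0 < q)%N -> ~ cvgn (fun k => o (n + k * q)).
Proof.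
move=> q0 /cvg_ex[l zl].
have l01 : 0 <= l <= 1.
  apply/andP; split.
    by apply: (cvgr_to_ge zl); near=> k; case/andP: (orbit01 (n + k * q)).
  by apply: (cvgr_to_le zl); near=> k; case/andP: (orbit01 (n + k * q)).
have zil i : (fun k => o (n + k * q + i)) @ \oo --> iter i f l.
  under eq_cvg do rewrite orbit_shift.
  by apply: cvg_iter => //; near=> k; exact: orbit01.
(* Applying f^q shifts the subsequence by one, so both sides are limits of the same sequence. *)
have lq : iter q f l = l.
  apply: (cvg_unique (@Rhausdorff R) (zil q)).
  have : (fun k => o (n + (k + 1) * q)) @ \oo --> l.
    by move: zl; rewrite -(cvg_shiftn 1).
  by under eq_cvg do rewrite addn1 mulSnr addnA.
have [[i ilc]|nolc] := pselect (exists i, iter i f l = c).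
  apply: (standing_not_periodic hs); exists q => //.
  by rewrite -ilc -iterD addnC iterD lq.
(* The q limits f^i(l) all differ from c, so the tail of the orbit keeps a positive distance from c,
   against recurrence. *)
have [d d0 [K dK]] : exists2 d : R, 0 < d & exists K, forall i k, (i < q)%N ->
    (K <= k)%N -> d <= `|o (n + k * q + i) - c|.
  elim: {1}q => [|r [d d0 [K dK]]]; first by exists 1 => //; exists 0%N.
  have rc : 0 < `|iter r f l - c| / 2.
    rewrite divr_gt0 // normr_gt0 subr_eq0; apply/eqP => h.
    by apply: nolc; exists r.
  have /cvgrPdist_lt /(_ _ rc) [K' _ hK'] := zil r.
  exists (Num.min d (`|iter r f l - c| / 2)); first by rewrite lt_min d0.
  exists (maxn K K') => i k; rewrite ltnS leq_eqVlt geq_max.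
  move=> /orP[/eqP ->|ir] /andP[Kk K'k].
    rewrite ge_min; apply/orP; right; have := hK' k K'k => /=.
    have := ler_distD (o (n + k * q + r)) (iter r f l) c; lra.
  by rewrite ge_min dK.
have [m [mN]] := recurrence _ (n + K * q) d0; apply/negP; rewrite -leNgt.
have -> : m = (n + ((m - n) %/ q) * q + (m - n) %% q)%N.
  by rewrite -addnA -divn_eq; lia.
by apply: dK; [rewrite ltn_mod|rewrite leq_divRL //; lia].
Unshelve. all: by end_near.
Qed.

(* The period is doubled so that the iterate preserves the order. *)
Lemma kneading_aperiodic n p : (0 < n)%N -> (0 < p)%N ->
  ~ (forall i, (n <= i)%N -> e (i + p)%N = e i).
Proof.
move=> n0 p0 per; pose q := (p + p)%N.
have perq i : (n <= i)%N -> e (i + q)%N = e i.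
  by move=> ni; rewrite /q addnA !per //; lia.
(* The two halves of the doubled period contain the same digits. *)
have even a : (n <= a)%N -> orientation a q = false.
  move=> na; rewrite /orientation /q big_split_ord oddD /=.
  rewrite [X in _ (+) odd X](eq_bigr (fun j : 'I_p => e (a + j)%N : nat)).
    by rewrite addbb.
  by move=> j _; rewrite addnCA addnC per //; lia.
have step a b : (n <= a)%N -> (n <= b)%N ->
    (forall j, e (a + j)%N = e (b + j)%N) -> o a <= o b -> o (a + q) <= o (b + q).
  move=> na nb ab /(le_iterate _ _ q (leq_trans n0 na) (leq_trans n0 nb)).
  by rewrite even //; apply=> j _; exact: ab.
have next k : (n + k.+1 * q = n + k * q + q)%N by rewrite mulSn; lia.
have same k j : e (n + k * q + j)%N = e (n + k.+1 * q + j)%N.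
  by rewrite next -(perq (n + k * q + j)%N); [congr e|]; lia.
apply: (@cvg_subsequence_false n q); first by rewrite addn_gt0 p0.
have [le|/ltW ge] := leP (o (n + 0 * q)) (o (n + 1 * q)).
- apply: nondecreasing_is_cvgn.
    apply/nondecreasing_seqP; elim=> [//|k ih].
    by rewrite [in leLHS]next [in leRHS]next; apply: step => // *; lia.
  by exists 1 => _ [k _ <-]; have /andP[] := orbit01 (n + k * q).
- apply: nonincreasing_is_cvgn.
    apply/nonincreasing_seqP; elim=> [//|k ih].
    by rewrite [in leLHS]next [in leRHS]next; apply: step => // *; lia.
  by exists 0 => _ [k _ <-]; have /andP[] := orbit01 (n + k * q).
Qed.

(** Without any disagreement the kneading sequence would have period n; so [least] does not return
    its default value. *)
Lemma agreeP n : (0 < n)%N -> [/\ (0 < agree f c n)%N,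
  e (n + agree f c n)%N <> e (agree f c n) &
  forall j, (0 < j < agree f c n)%N -> e (n + j)%N = e j].
Proof.
move=> n0; have [|[h1 h2] h3] :=
  leastP [set j | (1 <= j)%N /\ e (n + j)%N <> e j].
  apply: contrapT => none; apply: (kneading_aperiodic 1 n) => // i i1.
  by apply: contrapT => ne; apply: none; exists i; split; rewrite // addnC.
split=> // j /andP[j0 jlt]; apply: contrapT => ne.
by have := h3 j (conj j0 ne); rewrite leqNgt jlt.
Qed.

(** * Contraction principle: the distance from c_m to c against R(m) *)

Lemma between_iter x y z L : 0 <= x <= 1 -> 0 <= z <= 1 ->
  (forall j, (j < L)%N -> same_side (iter j f x) (iter j f z)) ->
  between x y z -> between (iter L f x) (iter L f y) (iter L f z).
Proof.
move=> x01 z01 + bt; elim: L => [//|L ih] H /=.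
apply: between_f; try exact: iter01; first exact: H.
by apply: ih => j jL; apply: H; rewrite ltnW.
Qed.

(** Since c is never strictly between the iterated endpoints, the image of the interval stays
    between the images of its endpoints, and the length bound passes to their distance. *)
Lemma contraction_iter (eps : R) : 0 < eps -> exists2 delta : R, 0 < delta &
  forall x y L, (0 < L)%N -> 0 <= x <= 1 -> 0 <= y <= 1 -> eps < `|x - y| ->
  (forall j, (j < L)%N -> same_side (iter j f x) (iter j f y)) ->
  delta < `|iter L f x - iter L f y|.
Proof.
move=> /(standing_contraction hs)[delta delta0 hdelta]; exists delta => //.
have main (x y : R) L : (0 < L)%N -> 0 <= x <= 1 -> 0 <= y <= 1 -> x <= y ->
    eps < y - x ->
    (forall j, (j < L)%N -> same_side (iter j f x) (iter j f y)) ->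
    delta < `|iter L f x - iter L f y|.
  move=> L0 x01 y01 xy xye H.
  apply: (lt_le_trans (hdelta L [set` `[x, y]] L0 _ _ _)).
  - exact: interval_is_interval.
  - by move=> w /=; rewrite !in_itv /=; lra.
  - by rewrite /ilength sup_itvcc // inf_itvcc.
  have ne : iter L f @` [set` `[x, y]] !=set0.
    by exists (iter L f x); apply: imageP; rewrite /= in_itv /= lexx.
  have hull w : (iter L f @` [set` `[x, y]]) w ->
      between (iter L f x) w (iter L f y).
    move=> [v /= + <-] /=; rewrite in_itv /= => xvy.
    by apply: between_iter => //; rewrite /between xvy.
  set a := iter L f x in hull *; set b := iter L f y in hull *.
  have hi : sup (iter L f @` [set` `[x, y]]) <= Num.max a b.
    apply: ge_sup => // w /hull; rewrite le_max /between.
    by case: (leP w a); case: (leP w b) => //=; lra.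
  have lo : Num.min a b <= inf (iter L f @` [set` `[x, y]]).
    apply: lb_le_inf => // w /hull; rewrite ge_min /between.
    by case: (leP a w); case: (leP b w) => //=; lra.
  apply: le_trans (lerB hi lo) _.
  by case: (leP a b) => ab; [rewrite distrC|]; apply: ler_norm.
move=> x y L L0 x01 y01 xy H; have [le|/ltW le] := leP x y.
  by apply: main => //; rewrite distrC ger0_norm ?subr_ge0 in xy.
rewrite distrC; apply: main => //; first by rewrite ger0_norm ?subr_ge0 in xy.
by move=> j /H; rewrite /same_side; tauto.
Qed.

(** Of three successively closer returns, two lie on the same side of c. *)
Lemma closer_return (delta : R) : 0 < delta -> exists n n',
  [/\ (0 < n < n')%N, e n = e n', `|o n - c| < delta &
      `|o n' - c| < `|o n - c|].
Proof.
move=> delta0.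
have next m : (0 < m)%N -> exists m', (m < m')%N /\ `|o m' - c| < `|o m - c|.
  move=> m0; apply: recurrence.
  by rewrite normr_gt0 subr_eq0; exact: orbit_neq.
have [n1 [n10 d1]] := recurrence _ 1 delta0.
have [n2 [n12 d2]] := next _ n10.
have [n3 [n23 d3]] := next _ (leq_trans n10 (ltnW n12)).
have [e12|ne12] := eqVneq (e n1) (e n2).
  by exists n1, n2; rewrite n10 n12.
have [e23|ne23] := eqVneq (e n2) (e n3).
  by exists n2, n3; rewrite (leq_trans n10 (ltnW n12)) n23; split=> //; lra.
exists n1, n3; rewrite n10 (ltn_trans n12 n23); split=> //; last by lra.
by case: (e n1) (e n2) (e n3) ne12 ne23 => -[] [].
Qed.

(* If the orbit of c_m shadows that of c for a long time, then by the
   contraction principle the interval between c_(m+n') and c_n' stays long,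
   hence contains the earlier return c_n, whose itinerary then agrees with
   that of c_n'. *)
Lemma agree_bounded (eps : R) : 0 < eps -> exists M, forall m, (0 < m)%N ->
  eps <= `|o m - c| -> (agree f c m <= M)%N.
Proof.
(* Halved because [contraction_iter] needs a strict lower bound. *)
move=> eps0; have eps20 : 0 < eps / 2 by lra.
have [delta delta0 far] := contraction_iter _ eps20.
have [n [n' [/andP[n0 nn'] enn' dn dn']]] := closer_return _ delta0.
have n'0 : (0 < n')%N by exact: ltn_trans nn'.
apply: contrapT => none.
have shadow L : exists m, [/\ (0 < m)%N, eps <= `|o m - c| &
    forall j, (0 < j <= L)%N -> e (m + j)%N = e j].
  apply: contrapT => nom; apply: none; exists L => m m0 me.
  have [_ _ agr] := agreeP m m0.
  rewrite leqNgt; apply/negP => Lagr; apply: nom; exists m; split=> // j.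
  by move=> /andP[j0 jL]; apply: agr; rewrite j0 (leq_ltn_trans jL).
have same j : e (n + j)%N = e (n' + j)%N.
  have [m [m0 me agr]] := shadow (n' + j)%N.
  have mn'0 : (0 < m + n')%N by rewrite addn_gt0 m0.
  have emn' : e (m + n')%N = e n' by rewrite agr // n'0 leq_addr.
  have dist : delta < `|o (m + n') - o n'|.
    rewrite orbit_shift; apply: far => //; [exact: orbit01|exact: c01|lra|].
    move=> [_|i /ltnW il].
      by rewrite /same_side /=; case: (leP (o m) c) => [|/ltW] h; [left|right].
    rewrite -orbit_shift; apply: kneading_same_side => //.
      by rewrite addnS.
    by rewrite agr // (leq_trans il) ?leq_addr.
  rewrite -(agr (n' + j)%N) ?addn_gt0 ?n'0 ?leqnn // addnA.
  apply: (between_agree (m + n') n n' j.+1) => //.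
    by move=> i ij; rewrite -addnA agr // addn_gt0 n'0 leq_add2l -ltnS.
  (* All three points are on one side of c. As c_n' is within delta of c, c_(m+n') can be more than
     delta away from it only by lying farther from c, beyond c_n. *)
  have := kneading_same_side n n' n0 n'0 enn'.
  have := kneading_same_side (m + n') n' mn'0 n'0 emn'.
  have := orbit_neq n' n'0; rewrite neq_lt /same_side /between.
  move: dist dn dn'; case: (ger0P (o n - c)) => ?; case: (ger0P (o n' - c)) => ?;
    case: (ger0P (o (m + n') - o n')) => ? ? ? ?; lra.
apply: (kneading_aperiodic n (n' - n)) => //; first by rewrite subn_gt0.
move=> i ni; have := same (i - n)%N.
by rewrite subnKC // => ->; congr e; lia.
Qed.

(** None of c_1, ..., c_M equals c, so by continuity points near c share these finitely many
    digits. *)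
Lemma agree_large M : exists2 eps : R, 0 < eps & forall m, (0 < m)%N ->
  `|o m - c| < eps -> (M < agree f c m)%N.
Proof.
have side j : \forall x \near c, (c < iter j.+1 f x) = e j.+1.
  have cvgj : (fun x => iter j.+1 f x) @ c --> o j.+1.
    apply: cvg_iter => //; last exact: c01.
    have /andP[c0 c1] := unimodal_turning hf.
    near=> x; apply/andP; split; apply: ltW; near: x.
      exact: lt_nbhsr.
    exact: lt_nbhsl.
  rewrite /kneading; have [lt|le] := ltP c (o j.+1).
    by near=> x; near: x; exact: (cvgr_gt _ cvgj).
  have {}lt : o j.+1 < c by rewrite lt_neqAle le andbT; exact: orbit_neq.
  near=> x; apply/negbTE; rewrite -leNgt; apply: ltW; near: x.
  exact: (cvgr_lt _ cvgj).
have /filter_forall : forall j : 'I_M,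
    \forall x \near c, (c < iter j.+1 f x) = e j.+1.
  by move=> j; exact: side.
move=> /nbhs_ballP[eps eps0 sub]; exists eps => // m m0 mc.
have [agr0 nagr _] := agreeP m m0; rewrite ltnNge; apply/negP => agrM.
have := sub (o m); rewrite /ball /= distrC => /(_ mc).
have agrM' : ((agree f c m).-1 < M)%N by rewrite prednK.
move=> /(_ (Ordinal agrM')) /=; rewrite -iterS prednK // -orbit_shift.
exact: nagr.
Unshelve. all: by end_near.
Qed.

(** * Sequences with A(k+1) = A(k) + R(A(k)) *)

Section AgreeSequence.
Context {A : nat -> nat}.
Hypotheses (A0_gt0 : (0 < A 0)%N)
  (AS : forall k, A k.+1 = (A k + agree f c (A k))%N).

Lemma agree_seq_gt0 k : (0 < A k)%N.
Proof. by elim: k => // k ih; rewrite AS addn_gt0 ih. Qed.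

Lemma agree_seq_inc k : (A k < A k.+1)%N.
Proof.
have [agr0 _ _] := agreeP _ (agree_seq_gt0 k).
by rewrite AS -addn1 leq_add2l.
Qed.

Lemma last_before_self k : last_before A (A k).+1 = A k.
Proof. by apply: (last_beforeE agree_seq_inc); rewrite ltnSn agree_seq_inc. Qed.

Lemma last_before_bound n : (A 0 < n)%N -> (0 < last_before A n < n)%N.
Proof.
move=> /(incr_bracket agree_seq_inc)[k kn].
rewrite (last_beforeE agree_seq_inc kn) agree_seq_gt0.
by case/andP: kn.
Qed.

(** After A(k) the digits repeat the kneading sequence from its start, and A(k+1) is the first place
    where they fail to. *)
Lemma agree_seqP n : (A 0 < n)%N ->
  (exists k, A k = n) <-> e n <> e (n - last_before A n)%N.
Proof.
move=> /(incr_bracket agree_seq_inc)[k kn].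
rewrite (last_beforeE agree_seq_inc kn).
have [_ neq eqs] := agreeP _ (agree_seq_gt0 k).
move: kn => /andP[kn]; rewrite leq_eqVlt => /orP[/eqP ->|nk].
  by rewrite AS addKn; split=> // _; exists k.+1.
split=> [[i Ain]|[]]; last first.
  have := eqs (n - A k)%N; rewrite subnKC ?(ltnW kn) //; apply.
  by rewrite subn_gt0 kn ltn_subLR ?(ltnW kn) // -AS.
have mono := incr_mono agree_seq_inc.
by move: kn nk; rewrite -Ain !mono; lia.
Qed.

Lemma last_before_skip n : (A 0 < n)%N -> e n = e (n - last_before A n)%N ->
  last_before A n.+1 = last_before A n.
Proof.
move=> A0n en; have [k kn] := incr_bracket agree_seq_inc A0n.
rewrite (last_beforeE agree_seq_inc kn); apply: (last_beforeE agree_seq_inc).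
case/andP: kn => kn; rewrite leq_eqVlt => /orP[/eqP nk|->]; last first.
  by rewrite ltnS ltnW.
by have /(agree_seqP _ A0n) : exists k, A k = n by exists k.+1.
Qed.

Lemma last_before_hit n : (A 0 < n)%N -> e n <> e (n - last_before A n)%N ->
  last_before A n.+1 = n.
Proof. by move=> A0n /(agree_seqP _ A0n)[k <-]; exact: last_before_self. Qed.

End AgreeSequence.

(** * Cutting times, co-cutting times and the interval around c_n *)

Local Notation s := (last_cutting f c).
Local Notation s' := (last_cocutting f c).
Local Notation T1 := (first_cocutting f c).

Let sE n : last_before (cutting_time f c) n = s n := erefl.
Let s'E n : last_before (cocutting_time f c) n = s' n := erefl.
Let cut0 : (0 < cutting_time f c 0)%N := erefl.
Let cutS k : cutting_time f c k.+1 =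
  (cutting_time f c k + agree f c (cutting_time f c k))%N := erefl.

Lemma kneading1 : e 1.
Proof. by case/andP: (standing_c2_c_c1 hs). Qed.

(** A further digit 1 exists, since otherwise the kneading sequence would be constant from index 2
    on. *)
Lemma first_cocuttingP :
  [/\ (1 < T1)%N, e T1 & forall j, (1 < j < T1)%N -> e j = false].
Proof.
have [|[h1 h2] h3] := leastP [set j | (1 < j)%N /\ e j].
  apply: contrapT => none; apply: (kneading_aperiodic 2 1) => // i i2.
  have no j : (1 < j)%N -> e j = false.
    by move=> j1; apply/negP => ej; apply: none; exists j.
  by rewrite !no //; lia.
split=> // j /andP[j1 jT]; apply/negP => ej.
by have := h3 j (conj j1 ej); rewrite leqNgt jT.
Qed.

Let cocut0 : (0 < cocutting_time f c 0)%N.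
Proof. by have [/ltnW] := first_cocuttingP. Qed.
Let cocutS i : cocutting_time f c i.+1 =
  (cocutting_time f c i + agree f c (cocutting_time f c i))%N := erefl.

(** The digits strictly between 1 and T_1 are 0 while e_1 = 1, so all these indices are cutting
    times; T_1 is not, as its digit is 1 again. *)
Lemma last_cutting_first_cocutting : s T1.+1 = T1.-1.
Proof.
have [T1_gt1 eT1 eT1'] := first_cocuttingP.
have cut n : (n.+2 <= T1)%N -> s n.+2 = n.+1.
  elim: n => [|n ih] nT; first exact: (last_before_self cut0 cutS 0).
  apply: (last_before_hit cut0 cutS) => //.
  by rewrite sE ih ?(ltnW nT) // subSnn kneading1 eT1'.
have cutT : s T1 = T1.-1 by case: T1 T1_gt1 cut => [|[|n]] // _; exact.
rewrite -cutT; apply: (last_before_skip cut0 cutS) => //.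
rewrite sE cutT; have -> : (T1 - T1.-1 = 1)%N by lia.
by rewrite kneading1 eT1.
Qed.

(** The interval [c_2, c_1] is invariant: its left part maps into [c_3, c_1], where c_2 < c_3, and
    its right part into [c_2, c_1]. *)
Lemma orbit_core i : (0 < i)%N -> o 2 <= o i <= o 1.
Proof.
have /ltW c23 := standing_c2_c3 hs.
have /andP[/ltW c2 /ltW c1] := standing_c2_c_c1 hs.
case: i => [//|i] _; elim: i => [|i /andP[ih2 ih1]].
  by rewrite lexx (le_trans c2 c1).
have /andP[i0 i1] := orbit01 i.+1; have /andP[h20 _] := orbit01 2.
have /andP[_ h11] := orbit01 1; have /andP[h0 h1] := c01.
have [le|/ltW le] := leP (o i.+1) c; apply/andP; split.
- by apply: (le_trans c23); apply: le_left.
- exact: le_left.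
- exact: le_right.
- exact: le_right.
Qed.

(* c_n = f^(n-1)(c_1), and H_n contains c_1. *)
Lemma orbit_in_Dtilde n : (T1 < n)%N ->
  between (o (n - s' n)) (o n) (o (n - s n)).
Proof.
have cutlt k : (T1 < k)%N -> (1 < k)%N.
  by have [+ _ _] := first_cocuttingP; apply: ltn_trans.
elim: n => // n ih; rewrite ltnS leq_eqVlt => /orP[/eqP <-|Tn].
  (* At T_1 + 1 the endpoints are c_1 and c_2. *)
  have [T1_gt1 _ _] := first_cocuttingP.
  rewrite last_cutting_first_cocutting.
  have -> : s' T1.+1 = T1 by exact: (last_before_self cocut0 cocutS 0).
  rewrite subSnn.
  have -> : (T1.+1 - T1.-1 = 2)%N by lia.
  by rewrite /between orbit_core ?orbT.
have /andP[s0 sn] := last_before_bound cut0 cutS n (cutlt _ Tn).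
have /andP[s'0 s'n] := last_before_bound cocut0 cocutS n Tn.
rewrite ?sE ?s'E in s0 sn s'0 s'n.
have n0 : (0 < n)%N by exact: leq_trans Tn.
have d0 : (0 < n - s n)%N by rewrite subn_gt0.
have d'0 : (0 < n - s' n)%N by rewrite subn_gt0.
have {}ih := ih Tn.
have bk := between_kneading _ _ _ d'0 n0 d0 ih.
have [en|/eqP en] := eqVneq (e n) (e (n - s n)%N).
  have -> : s n.+1 = s n by exact: (last_before_skip cut0 cutS n (cutlt _ Tn) en).
  have [en'|/eqP en'] := eqVneq (e n) (e (n - s' n)%N).
    have -> : s' n.+1 = s' n by exact: (last_before_skip cocut0 cocutS n Tn en').
    rewrite !subSn 1?ltnW //.
    apply: between_f ih; try exact: orbit01.
    by apply: kneading_same_side; rewrite // -en'.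
  (* At a co-cutting time c separates c_n from one endpoint; c replaces that endpoint, and its image
     is c_1. *)
  have -> : s' n.+1 = n by exact: (last_before_hit cocut0 cocutS n Tn en').
  rewrite subSnn subSn 1?ltnW //.
  apply: (between_f c) => //; [exact: c01|exact: orbit01|exact: side_turning|].
  exact: (between_turning (n - s' n)).
have -> : s n.+1 = n by exact: (last_before_hit cut0 cutS n (cutlt _ Tn) en).
(* If both endpoints had the digit opposite to e_n, they would be on one side of c, and c_n between
   them on that side too. *)
have en' : e n = e (n - s' n)%N.
  by move: en bk; case: (e n) (e (n - s n)%N) (e (n - s' n)%N) => -[] [] //= _ ->.
have -> : s' n.+1 = s' n by exact: (last_before_skip cocut0 cocutS n Tn en').
rewrite subSnn subSn 1?ltnW //; rewrite betweenC.
apply: (between_f c) => //; [exact: c01|exact: orbit01|exact: side_turning|].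
by apply: (between_turning (n - s n)); rewrite // betweenC.
Qed.

Lemma sub_last_gt0 n : (T1 < n)%N -> (0 < n - s n)%N /\ (0 < n - s' n)%N.
Proof.
move=> Tn; have n1 : (1 < n)%N.
  by have [h _ _] := first_cocuttingP; exact: ltn_trans Tn.
have /andP[_ sn] := last_before_bound cut0 cutS n n1.
have /andP[_ s'n] := last_before_bound cocut0 cocutS n Tn.
by rewrite !subn_gt0.
Qed.

(* Also uses that no n is both a cutting and a co-cutting time: otherwise c_n
   and the two endpoints would be on different sides of c, although c_n lies
   between the endpoints. *)
Lemma Dtilde_turning n : (T1 < n)%N ->
  Dtilde f c n c <-> is_cutting f c n \/ is_cocutting f c n.
Proof.
move=> Tn; have n1 : (1 < n)%N.
  by have [h _ _] := first_cocuttingP; exact: ltn_trans Tn.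
have [d0 d'0] := sub_last_gt0 n Tn.
have := between_kneading _ _ _ d'0 (ltnW n1) d0 (orbit_in_Dtilde n Tn).
have := agree_seqP cocut0 cocutS n Tn; have := agree_seqP cut0 cutS n n1.
rewrite sE s'E -/(is_cutting f c n) -/(is_cocutting f c n) => -> ->.
have -> : Dtilde f c n c <-> e (n - s n)%N <> e (n - s' n)%N.
  have := kneadingN _ d0; have := kneadingN _ d'0.
  rewrite /Dtilde /= in_itv /= gt_min lt_max /kneading.
  by case: (ltrgtP c (o (n - s n))); case: (ltrgtP c (o (n - s' n))).
by case: (e n) (e (n - s n)%N) (e (n - s' n)%N) => -[] [] /=; intuition.
Qed.

End Kneading.

(** * Neighbourhoods of c against values of R at the endpoints *)

Theorem theorem3p22 (R : realType) (f : R -> R) (c : R)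
    (hf : unimodal f c) (hs : standing_assumptions f c) :
  (forall U : set R, symmetric_nbhd c U ->
     exists N : nat, forall n : nat, (N < n)%N -> ~ (U `<=` Dtilde f c n))
  <->
  (forall M : nat, exists N : nat, forall n : nat, (N <= n)%N ->
     is_cutting f c n \/ is_cocutting f c n ->
     (M < agree f c (n - last_cutting f c n))%N \/
     (M < agree f c (n - last_cocutting f c n))%N).
Proof.
split=> [small M|large U [u uc ->]].
- have [eps eps0 near] := agree_large hf hs M.
  have [|N hN] := small [set` `]c - eps, 2 * c - (c - eps)[].
    by exists (c - eps) => //; lra.
  exists (maxn N (first_cocutting f c)).+1 => n; rewrite gtn_max => /andP[Nn Tn].
  have [d0 d'0] := sub_last_gt0 hf hs n Tn.
  move=> /(Dtilde_turning hf hs n Tn) cD.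
  apply: contrapT => /not_orP[/negP]; rewrite -leqNgt => R1.
  move=> /negP; rewrite -leqNgt => R2.
  have far m : (0 < m)%N -> (agree f c m <= M)%N -> eps <= `|iter m f c - c|.
    by move=> m0; rewrite leNgt leqNgt; apply: contraNN; exact: near.
  have := far _ d0 R1; have := far _ d'0 R2; move=> h2 h1.
  (* The interval contains c and both its endpoints are at least eps away from c, so it contains the
     whole neighbourhood of radius eps. *)
  apply: (hN n Nn) => x; move: cD; rewrite /Dtilde /= !in_itv /=.
  move: h1 h2; set a := iter (n - last_cocutting f c n) f c.
  set b := iter (n - last_cutting f c n) f c.
  rewrite !gt_min !lt_max.
  case: (ger0P (b - c)) => ?; case: (ger0P (a - c)) => ?; lra.
- have [|M hM] := agree_bounded hf hs (c - u); first by rewrite subr_gt0.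
  have [N hN] := large M; exists (maxn N (first_cocutting f c)) => n.
  rewrite gtn_max => /andP[Nn Tn] sub.
  have [d0 d'0] := sub_last_gt0 hf hs n Tn.
  have near m : (0 < m)%N -> (M < agree f c m)%N -> `|iter m f c - c| < c - u.
    by move=> m0; rewrite ltNge ltnNge; apply: contraNN; exact: hM.
  (* An endpoint with R above M would lie in U, hence in the open interval that it bounds. *)
  have inU m : (0 < m)%N -> (M < agree f c m)%N -> Dtilde f c n (iter m f c).
    move=> m0 /(near m m0); rewrite ltr_distl => h; apply: sub.
    by rewrite /= in_itv /=; lra.
  have cD : Dtilde f c n c by apply: sub; rewrite /= in_itv /=; lra.
  have := hN n (ltnW Nn) ((Dtilde_turning hf hs n Tn).1 cD).
  case=> /(inU _ _); [move=> /(_ d0)|move=> /(_ d'0)];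
    by rewrite /Dtilde /= in_itv /= gt_min lt_max !ltxx ?orbF /=; case: ltrgtP.
Qed.
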